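(* For every partition $\lambda$ of a positive integer $n$, $$d_\lambda=(-1)^{|\lambda|-\lambda_1}\,f^\lambda\,D^\lambda .$$
   Context: $d_\lambda:=\sum_{\pi\in D_n}\chi^\lambda(\pi)$, where $\chi^\lambda$ is the irreducible character of $S_n$ indexed by $\lambda\vdash n$ and $D_n\subseteq S_n$ is the set of fixed-point-free permutations. $f^\lambda:=\chi^\lambda(1)$ is the number of standard Young tableaux of shape $\lambda$. Let $\lambda'$ be the conjugate partition, $[m]=\{1,\dots,m\}$, and $$\mathcal{S}_\lambda=\{(c,\sigma): c\in[\lambda'_1]\times\cdots\times[\lambda'_{\lambda_1}],\ \sigma\in S_{\lambda_1},\ \sigma(i)=j\Rightarrow c_i=c_j\ \text{for all } i\in[\lambda_1]\}.$$ An element $(c,\sigma)\in\mathcal{S}_\lambda$ is a derangement if $\sigma(i)=i$ implies $c_i\ne1$ for all $1\le i\le\lambda_1$. $D^\lambda$ is the number of derangements in $\mathcal{S}_\lambda$. *)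

(* Defs.v *)
(* Mathematical Components (no classical axioms). *)
From HB Require Import structures.
From mathcomp Require Import all_boot all_order all_algebra.
From mathcomp Require Import all_fingroup all_solvable all_field all_character.
Set Implicit Arguments.
Unset Strict Implicit.
Unset Printing Implicit Defensive.
Import GroupScope GRing.Theory Num.Theory.
Local Open Scope ring_scope.

Definition is_partition_of (n : nat) (lam : seq nat) : bool :=
  [&& sorted geq lam, 0%N \notin lam & sumn lam == n].

Definition first_part (lam : seq nat) : nat := head 0%N lam.

(* Column j (0-based) of the diagram has one cell for each part larger than j. *)
Definition conj_part (lam : seq nat) (j : nat) : nat :=
  count (fun r => j < r)%N lam.

(* The cells of the diagram of lam are identified with 'I_n, n = |lam|, by
   reading the rows from left to right and from top to bottom: i : 'I_n lies in
   row reshape_index lam i and column reshape_offset lam i (0-based). *)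
Definition row_stab (n : nat) (lam : seq nat) : {set 'S_n} :=
  [set s : 'S_n | [forall i, reshape_index lam (s i) == reshape_index lam i]].

Definition col_stab (n : nat) (lam : seq nat) : {set 'S_n} :=
  [set s : 'S_n | [forall i, reshape_offset lam (s i) == reshape_offset lam i]].

(* An element of the group algebra of 'S_n is a row vector of coordinates in
   the basis 'S_n, as in regular_repr; delta_mx 0 (gring_index _ x) is the
   basis vector x. *)
Definition young_symmetrizer (n : nat) (lam : seq nat) :
    'rV[algC]_#|[set: 'S_n]| :=
  \sum_(p in row_stab n lam) \sum_(q in col_stab n lam)
     (-1) ^+ q *: delta_mx 0 (gring_index [set: 'S_n] (p * q)%g).

(* The Specht module of lam is the ideal of the group algebra generated by the
   Young symmetrizer.  It is a right ideal for the product of permutations used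
   here, (p * q) i = q (p i), hence a left ideal for the usual composition. *)
Definition specht_repr (n : nat) (lam : seq nat) :=
  submod_repr (cyclic_mx_module (regular_repr algC [set: 'S_n]%G)
                                (young_symmetrizer n lam)).

Definition chi (n : nat) (lam : seq nat) : 'CF([set: 'S_n]) :=
  cfRepr (specht_repr n lam).

Definition fixed_point_free (n : nat) : {set 'S_n} :=
  [set s : 'S_n | [forall i, s i != i]].

Definition derangement_char_sum (n : nat) (lam : seq nat) : algC :=
  \sum_(s in fixed_point_free n) chi n lam s.

Definition char_degree (n : nat) (lam : seq nat) : algC := chi n lam 1%g.

(* Coordinates are 0-based: c i : 'I_(conj_part lam i) stands for the element
   (c i).+1 of [lambda'_(i+1)]; in particular "c_i <> 1" reads c i != 0. *)
Definition colored_perms (lam : seq nat) :=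
  [set cs : {dffun forall i : 'I_(first_part lam), 'I_(conj_part lam i)}
              * 'S_(first_part lam) |
    [forall i, cs.1 i == cs.1 (cs.2 i) :> nat]].

Definition colored_derangements (lam : seq nat) :=
  [set cs in colored_perms lam |
    [forall i, (cs.2 i == i) ==> (cs.1 i != 0 :> nat)]].

Definition num_colored_derangements (lam : seq nat) : nat :=
  #|colored_derangements lam|.

(* Main.v *)
(* Let a and b be the row sum and the signed column sum, so that a b is the
   Young symmetrizer.  By von Neumann's lemma a x b vanishes unless x = p q with
   p in the row stabilizer and q in the column stabilizer, and then it equals
   sgn(q) a b.  The sum of all derangements is central, so it acts on the Specht
   module by the scalar sum of sgn(q) over the pairs (p, q) with p q fixed-point
   free, and d_lambda is this scalar times f^lambda.

   As p keeps rows and q keeps columns, p q fixes a cell iff both p and q do.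
   Inclusion-exclusion over a set A of cells supporting both p and q leaves, for
   each p and A, the signed sum of the q supported in A; it is 1 if A meets each
   column at most once and 0 otherwise.  Such pairs (p, A) correspond to triples
   (c, sigma, B), where (c, sigma) is a colored permutation and B is a set of
   indices i with sigma(i) = i and c_i = 1: A consists of the cells (c_i, i) with
   i not in B, and p moves (c_i, i) to (c_i, sigma(i)).  Summing over B is the
   inclusion-exclusion that counts colored derangements. *)

Require Import Defs.
From HB Require Import structures.
From mathcomp Require Import all_boot all_order all_algebra.
From mathcomp Require Import all_fingroup all_solvable all_field all_character.
Set Implicit Arguments.
Unset Strict Implicit.
Unset Printing Implicit Defensive.
Import GRing.Theory Num.Theory.
Local Open Scope ring_scope.

(** * Signed sums *)

Lemma eq_oppr_algC (V : lmodType algC) (v : V) : v = - v -> v = 0.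
Proof.
move=> vN; apply/eqP; have: (2%:R : algC) *: v == 0.
  by rewrite scaler_nat mulr2n {2}vN subrr.
by rewrite scaler_eq0 pnatr_eq0.
Qed.

(** Reindexing by [h] turns the sum into its opposite; at fixed points of [h] the summand is already
    0. *)
Lemma sum_sign_reversing (I : finType) (P : pred I) (F : I -> algC)
    (h : I -> I) :
    involutive h -> (forall i, P (h i) = P i) ->
    (forall i, F (h i) = - F i) ->
  \sum_(i | P i) F i = 0.
Proof.
move=> hK Ph Fh; apply: (@eq_oppr_algC algC^o).
rewrite {1}(reindex_inj (can_inj hK)) -sumrN.
by apply: eq_big => // i _; apply: Fh.
Qed.

(** Adding or removing a chosen element of a nonempty [Z] reverses the sign. *)
Lemma sum_subset_sign (I : finType) (Z : {set I}) :
  \sum_(A : {set I} | A \subset Z) (-1) ^+ #|A| = (Z == set0)%:R :> algC.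
Proof.
have [-> | [z Zz]] := set_0Vmem Z.
  by rewrite eqxx (big_pred1 set0) ?cards0 // => A; rewrite subset0.
have /negbTE-> : Z != set0 by apply/set0Pn; exists z.
pose h (A : {set I}) := if z \in A then A :\ z else z |: A.
apply: (@sum_sign_reversing _ _ _ h) => A; rewrite /h.
- by have [zA | zA] := boolP (z \in A); rewrite ?setD11 ?setU11 ?setU1K ?setD1K.
- case: ifP => zA; last by rewrite subUset sub1set Zz.
  by rewrite subDset (setUidPr _) // sub1set.
- case: ifP => zA; last by rewrite cardsU1 zA exprS mulN1r.
  by rewrite [in RHS](cardsD1 z) zA exprS mulN1r opprK.
Qed.

(** A total encoding with the identity as default, so that a permutation can be named before
    injectivity of [f] is known. *)
Definition perm_of (T : finType) (f : T -> T) : {perm T} :=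
  odflt 1%g [pick s : {perm T} | [forall x, s x == f x]].

Lemma perm_ofE (T : finType) (f : T -> T) : injective f -> perm_of f =1 f.
Proof.
move=> f_inj x; rewrite /perm_of; case: pickP => [s /forallP sf | no_s].
  exact/eqP/sf.
by have /forallP[] := no_s (perm f_inj) => y; rewrite permE.
Qed.

(** * Stabilizers of the fibers of a function *)

Section FiberStabilizer.

Variables (T : finType) (f : T -> nat).

Definition fiber_stab : {set {perm T}} :=
  [set s : {perm T} | [forall i, f (s i) == f i]].

Lemma fiber_stabP (s : {perm T}) :
  reflect (forall i, f (s i) = f i) (s \in fiber_stab).
Proof. by rewrite inE; apply: (iffP forallP) => fs i; apply/eqP. Qed.

Lemma fiber_stab_group_set : group_set fiber_stab.
Proof.
apply/group_setP; split=> [|s t /fiber_stabP fs /fiber_stabP ft].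
  by apply/fiber_stabP => i; rewrite perm1.
by apply/fiber_stabP => i; rewrite permM ft fs.
Qed.
Canonical fiber_stab_group := Group fiber_stab_group_set.

Lemma tperm_fiber_stab i j : f i = f j -> tperm i j \in fiber_stab.
Proof. by move=> fij; apply/fiber_stabP => k; case: tpermP => [->|->|]. Qed.

(** If [f] is injective on [A], only the identity occurs. Otherwise two points of [A] share a fiber,
    and multiplying by their transposition reverses signs. *)
Lemma sum_sign_fiber_stab (A : {set T}) :
  \sum_(s in fiber_stab | perm_on A s) (-1) ^+ s
    = (dinjectiveb f [in A])%:R :> algC.
Proof.
have [/dinjectiveP f_inj | /dinjectivePn[i Ai [j /andP[ji Aj] fij]]] :=
  boolP (dinjectiveb f [in A]).
  rewrite (big_pred1 1%g) ?odd_perm1 // => s /=; apply/andP/eqP => [|->].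
    case=> /fiber_stabP fs sA; apply/permP => i; rewrite perm1.
    have [Ai | A'i] := boolP (i \in A); last exact: out_perm sA A'i.
    by apply: f_inj; rewrite ?fs ?inE ?(perm_closed _ sA).
  by rewrite group1 perm_on1.
have tA : perm_on A (tperm i j).
  by apply/subsetP => k; rewrite inE; case: tpermP => [->|->|]; rewrite ?eqxx.
apply: (@sum_sign_reversing _ _ _ (mulg (tperm i j))) => s.
- by rewrite mulgA tperm2 mul1g.
- rewrite groupMl ?tperm_fiber_stab //; congr (_ && _).
  apply/idP/idP => [tsA|]; last exact: perm_onM.
  by rewrite -(mul1g s) -(tperm2 i j) -mulgA perm_onM.
- by rewrite odd_mul_tperm eq_sym ji /= signrN.
Qed.

End FiberStabilizer.

(** * Products of a row permutation and a column permutation *)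

Section RowColumn.

Variables (T : finType) (row col : T -> nat).
Hypothesis rowcol_inj : forall x y, row x = row y -> col x = col y -> x = y.

Lemma fiber_stabI (s : {perm T}) :
  s \in fiber_stab row -> s \in fiber_stab col -> s = 1%g.
Proof.
move=> /fiber_stabP Ps /fiber_stabP Qs; apply/permP => i.
by rewrite perm1; apply: rowcol_inj.
Qed.

Lemma fiber_stab_mul_inj (p q p' q' : {perm T}) :
    p \in fiber_stab row -> q \in fiber_stab col ->
    p' \in fiber_stab row -> q' \in fiber_stab col ->
  (p * q = p' * q')%g -> p = p' /\ q = q'.
Proof.
move=> Pp Qq Pp' Qq' eq_pq; have def1 : (p'^-1 * p = q' * q^-1)%g.
  by apply: (mulIg q); rewrite -mulgA eq_pq mulgKV mulKg.
have /(canRL (mulKVg _)) : (p'^-1 * p)%g = 1%g.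
  apply: fiber_stabI; first by rewrite groupM ?groupV.
  by rewrite def1 groupM ?groupV.
by rewrite mulg1 => def_p; split=> //; move: eq_pq; rewrite def_p => /mulgI.
Qed.

(** If [q (p i) = i], then [p i] shares its row with [i] because of [p] and its column because of
    [q], so [p i = i]. *)
Lemma fiber_stab_mul_fix (p q : {perm T}) i :
    p \in fiber_stab row -> q \in fiber_stab col ->
  ((p * q)%g i == i) = (p i == i) && (q i == i).
Proof.
move=> /fiber_stabP Pp /fiber_stabP Qq; rewrite permM.
apply/eqP/andP => [pqi | [/eqP-> /eqP //]].
have pi : p i = i by apply: rowcol_inj; rewrite ?Pp // -[in RHS]pqi Qq.
by move: pqi; rewrite pi => ->; rewrite eqxx.
Qed.

Lemma sum_sign_fixed_point_free :
  \sum_(p in fiber_stab row)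
     \sum_(q in fiber_stab col | [forall i, (p * q)%g i != i]) (-1) ^+ q
  = \sum_(p in fiber_stab row)
      \sum_(A : {set T} | perm_on A p && dinjectiveb col [in A])
         (-1) ^+ #|~: A| :> algC.
Proof.
apply: eq_bigr => p Pp.
transitivity (\sum_(q in fiber_stab col)
    \sum_(A : {set T} | perm_on A p && perm_on A q)
       (-1) ^+ q * (-1) ^+ #|~: A| : algC).
  rewrite [LHS]big_mkcondr /=; apply: eq_bigr => q Qq; rewrite -mulr_sumr.
  (* After complementation, [A] runs over the subsets of the fixed points of [p * q]; the
     alternating sum detects that there are none. *)
  rewrite (reindex_inj (inv_inj (@setCK T))) /=.
  rewrite (eq_bigl (fun A : {set T} => A \subset [set i | (p * q)%g i == i])) => [|A].
    under eq_bigr do rewrite setCK.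
    rewrite sum_subset_sign mulr_natr mulrb; congr (if _ then _ else _).
    apply/forallP/eqP => [fpf | fix0 i].
      by apply/setP => i; rewrite !inE (negbTE (fpf i)).
    by move/setP/(_ i): fix0; rewrite !inE => ->.
  apply/andP/subsetP => [[pA qA] i Ai | fixA].
    rewrite inE fiber_stab_mul_fix //.
    by rewrite !(out_perm pA, out_perm qA) ?inE ?Ai ?eqxx.
  split; apply/subsetP => i; rewrite !inE; apply: contra => /fixA;
    by rewrite inE fiber_stab_mul_fix // => /andP[].
rewrite (exchange_big_dep (fun A : {set T} => perm_on A p)) => [|q A _ /andP[]//] /=.
rewrite [RHS]big_mkcondr /=; apply: eq_bigr => A pA.
rewrite -mulr_suml (eq_bigl (fun q => (q \in fiber_stab col) && perm_on A q)).
  by rewrite sum_sign_fiber_stab; case: dinjectiveb; rewrite ?mul1r ?mul0r.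
by move=> q; rewrite pA.
Qed.

End RowColumn.

(** * Cells of a Young diagram *)

Section Cells.

Variable lam : seq nat.
Hypothesis lam_sorted : sorted geq lam.

Local Notation n := (sumn lam).
Local Notation k := (first_part lam).

Definition cell_row (x : 'I_n) : nat := reshape_index lam x.
Definition cell_col (x : 'I_n) : nat := reshape_offset lam x.

Lemma cell_inj x y : cell_row x = cell_row y -> cell_col x = cell_col y -> x = y.
Proof.
move=> eq_r eq_c; apply: val_inj.
rewrite /= -[LHS](reshape_indexK lam) -[RHS](reshape_indexK lam).
exact: congr2 eq_r eq_c.
Qed.

Definition cell r c (lt_c : (c < nth 0%N lam r)%N) : 'I_n :=
  Ordinal (flatten_indexP lt_c).

Lemma cell_rowK r c (lt_c : (c < nth 0%N lam r)%N) : cell_row (cell lt_c) = r.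
Proof. exact: flatten_indexKl. Qed.

Lemma cell_colK r c (lt_c : (c < nth 0%N lam r)%N) : cell_col (cell lt_c) = c.
Proof. exact: flatten_indexKr. Qed.

Lemma cell_row_lt x : (cell_row x < size lam)%N.
Proof. exact: reshape_indexP. Qed.

Lemma cell_col_row x : (cell_col x < nth 0%N lam (cell_row x))%N.
Proof. exact: reshape_offsetP. Qed.

(** As [lam] is weakly decreasing, the parts exceeding [c] form an initial segment. *)
Lemma conj_partP r c : (r < conj_part lam c)%N = (c < nth 0%N lam r)%N.
Proof.
rewrite /conj_part; elim: lam lam_sorted r => [|a l IHl] /=; first by move=> _ [].
move=> al r; have [lt_ca | le_ac] := ltnP c a.
  by case: r => [|r]; rewrite ?lt_ca ?add1n ?ltnS ?IHl ?(path_sorted al).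
have le_la x : x \in l -> (x <= a)%N.
  by move/(order_path_min (rev_trans leq_trans))/allP: al => /[apply].
have -> : count (fun r => c < r)%N l = 0.
  apply/eqP; rewrite -leqn0 leqNgt -has_count; apply/hasPn => x /le_la le_xa.
  by rewrite -leqNgt (leq_trans le_xa).
rewrite ltn0; apply/esym/negbTE; rewrite -leqNgt.
case: r => //= r; have [lt_r | le_r] := ltnP r (size l).
  by rewrite (leq_trans _ le_ac) // le_la ?mem_nth.
by rewrite nth_default.
Qed.

Lemma cell_row_conj x : (cell_row x < conj_part lam (cell_col x))%N.
Proof. by rewrite conj_partP cell_col_row. Qed.

Lemma cell_col_lt x : (cell_col x < k)%N.
Proof.
rewrite /first_part -nth0 -conj_partP.
exact: leq_ltn_trans (cell_row_conj x).
Qed.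

Definition ord_col (x : 'I_n) : 'I_k := Ordinal (cell_col_lt x).

(* If [x] sends no two cells of a row to the same column, then each row has at
   most as many cells sent to the first [m] columns as it has cells there; the
   totals agree, hence so do the two counts in each row. *)
Lemma cell_col_perm_lt (x : 'S_n) i :
    (forall i j, cell_row i = cell_row j ->
       cell_col (x i) = cell_col (x j) -> i = j) ->
  (cell_col (x i) < nth 0%N lam (cell_row i))%N.
Proof.
move=> x_inj; set m := nth 0%N lam _.
pose A (r : 'I_(size lam)) := [set j | (cell_row j == r) && (cell_col j < m)%N].
pose B (r : 'I_(size lam)) :=
  [set j | (cell_row j == r) && (cell_col (x j) < m)%N].
have leBA r : (#|B r| <= #|A r| ?= iff (#|B r| == #|A r|))%N.
  (* If row [r] has at least [m] cells, [A r] has [m] of them, while the cells of [B r] have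
     distinct target columns below [m]. Otherwise [A r] is the whole row. *)
  apply/leqif_eq; have [le_m | lt_m] := leqP m (nth 0%N lam r).
    apply: (@leq_trans m).
      have colB (j : 'I_n) : j \in B r -> (cell_col (x j) < m)%N.
        by rewrite inE => /andP[].
      have [m0 | m_gt0] := posnP m.
        rewrite m0 leqn0 cards_eq0; apply/eqP/setP => j.
        by rewrite !inE m0 andbF.
      pose g j := insubd (Ordinal m_gt0) (cell_col (x j)).
      have g_inj : {in B r &, injective g}.
        move=> j j' Bj Bj' /(congr1 val); rewrite !val_insubd !colB //.
        apply: x_inj; move: Bj Bj'; rewrite !inE.
        by move=> /andP[/eqP-> _] /andP[/eqP-> _].
      rewrite -(card_in_imset g_inj); apply: leq_trans (max_card _) _.
      by rewrite card_ord.
    pose g (c : 'I_m) := cell (leq_trans (ltn_ord c) le_m).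
    have g_inj : injective g.
      by move=> c c' /(congr1 cell_col); rewrite !cell_colK; apply: val_inj.
    have := card_imset [set: 'I_m] g_inj; rewrite cardsT card_ord => {1}<-.
    apply/subset_leq_card/subsetP => _ /imsetP[c _ ->].
    by rewrite inE cell_rowK cell_colK eqxx /=.
  apply/subset_leq_card/subsetP => j; rewrite !inE => /andP[/eqP rj _].
  by rewrite rj eqxx (leq_trans _ (ltnW lt_m)) // -rj cell_col_row.
have sum_fib (P : pred 'I_n) :
    (\sum_(r < size lam) #|[set j | (cell_row j == r) && P j]| = #|P|)%N.
  rewrite -[RHS]sum1_card.
  rewrite (partition_big (fun j => Ordinal (cell_row_lt j)) predT) //=.
  apply: eq_bigr => r _; rewrite -sum1_card; apply: eq_bigl => j.
  by rewrite inE andbC.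
have eq_tot : #|[pred j | cell_col (x j) < m]%N| = #|[pred j | cell_col j < m]%N|.
  by rewrite -!sum1_card [RHS](reindex_inj (@perm_inj _ x)).
have [_] := leqif_sum (fun r (_ : xpredT r) => leBA r).
rewrite !sum_fib eq_tot eqxx.
move=> /esym/forallP/(_ (Ordinal (cell_row_lt i)))/=/eqP eqBA.
have: i \in B (Ordinal (cell_row_lt i)); last by rewrite inE => /andP[].
(* The row of [i] has length [m], so [A] there is all of [R]; equal cardinals make [B] all of [R]
   too. *)
pose R := [set j | cell_row j == cell_row i].
have sBR : B (Ordinal (cell_row_lt i)) \subset R.
  by apply/subsetP => j; rewrite !inE => /andP[].
suffices -> : B (Ordinal (cell_row_lt i)) = R by rewrite inE.
apply/eqP; rewrite eqEcard sBR eqBA subset_leq_card //.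
apply/subsetP => j; rewrite !inE => /eqP rj; rewrite rj eqxx /=.
by rewrite /m -rj cell_col_row.
Qed.

(** Let [p] send each cell, within its row, to the column that [x] gives it; the preceding bound
    says that this cell exists. Then [p^-1 * x] keeps columns. *)
Lemma fiber_stab_mulP (x : 'S_n) :
    (forall i j, cell_row i = cell_row j ->
       cell_col (x i) = cell_col (x j) -> i = j) ->
  exists p q, [/\ p \in fiber_stab cell_row, q \in fiber_stab cell_col
                & x = (p * q)%g].
Proof.
move=> x_inj; pose f i := cell (cell_col_perm_lt i x_inj).
have f_inj : injective f.
  move=> i j eq_f; apply: (x_inj).
    by have := congr1 cell_row eq_f; rewrite !cell_rowK.
  by have := congr1 cell_col eq_f; rewrite !cell_colK.
exists (perm f_inj), ((perm f_inj)^-1 * x)%g; split; last by rewrite mulKVg.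
  by apply/fiber_stabP => i; rewrite permE cell_rowK.
apply/fiber_stabP => i; rewrite permM.
by rewrite -[i in RHS](permKV (perm f_inj)) [in RHS]permE cell_colK.
Qed.

(** * The action on a Young symmetrizer *)

Section YoungSymmetrizer.

Local Notation G := [set: 'S_n]%G.
Local Notation P := (fiber_stab cell_row).
Local Notation Q := (fiber_stab cell_col).

Variables (m : nat) (rG : mx_representation algC G m).

Definition row_sum : 'M[algC]_m := \sum_(p in P) rG p.
Definition col_sum : 'M[algC]_m := \sum_(q in Q) (-1) ^+ q *: rG q.

Lemma row_sum_mul p : p \in P -> row_sum *m rG p = row_sum.
Proof.
move=> Pp; rewrite mulmx_suml [RHS](reindex_inj (mulIg p)) /=.
apply: eq_big => s; first by rewrite groupMr.
by rewrite repr_mxM ?inE.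
Qed.

Lemma mul_col_sum q : q \in Q -> rG q *m col_sum = (-1) ^+ q *: col_sum.
Proof.
move=> Qq; rewrite mulmx_sumr scaler_sumr [RHS](reindex_inj (mulgI q)) /=.
apply: eq_big => s; first by rewrite groupMl.
by rewrite scalerA odd_permM signr_addb signrMK repr_mxM ?inE // scalemxAr.
Qed.

(** The row transposition of [i] and [j] is absorbed on the left with sign 1; carried across [x], it
    is a column transposition absorbed on the right with sign -1. *)
Lemma young_sandwich_eq0 (x : 'S_n) i j :
    cell_row i = cell_row j -> cell_col (x i) = cell_col (x j) -> i != j ->
  row_sum *m rG x *m col_sum = 0.
Proof.
move=> rij cij ij; apply: eq_oppr_algC.
rewrite -{1}(row_sum_mul (tperm_fiber_stab rij)) -mulmxA -mulmxA.
rewrite (mulmxA (rG _)) -repr_mxM ?inE //.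
have -> : (tperm i j * x = x * tperm (x i) (x j))%g by rewrite -tpermJ conjgC.
rewrite repr_mxM ?inE // -mulmxA mul_col_sum ?tperm_fiber_stab //.
by rewrite odd_tperm (inj_eq perm_inj) ij expr1 scaleN1r !mulmxN mulmxA.
Qed.

Lemma young_sandwich_sum (A : {set 'S_n}) :
  row_sum *m (\sum_(x in A) rG x) *m col_sum
    = (\sum_(p in P) \sum_(q in Q | (p * q)%g \in A) (-1) ^+ q)
        *: (row_sum *m col_sum).
Proof.
pose h (pq : 'S_n * 'S_n) := (pq.1 * pq.2)%g.
pose PQ := [set pq in setX P Q | h pq \in A].
have h_inj : {in PQ &, injective h}.
  move=> [p q] [p' q'] /setIdP[/setXP[Pp Qq] _] /setIdP[/setXP[Pp' Qq'] _].
  by case/(fiber_stab_mul_inj cell_inj Pp Qq Pp' Qq') => -> ->.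
have -> U V : U *m (\sum_(x in A) rG x) *m V = \sum_(x in A) U *m rG x *m V.
  by rewrite mulmx_sumr mulmx_suml.
(* The products [p * q] yield the scalar, each pair counted once as [h] is injective. Any other [x]
   sends two cells of a row to one column, so its term vanishes. *)
rewrite (bigID [in h @: PQ]) /= addrC big1 ?add0r.
  rewrite (eq_bigl [in h @: PQ]) => [|x]; last first.
    by apply: andb_idl => /imsetP[pq /setIdP[_ Apq] ->].
  rewrite big_imset //= pair_big_dep scaler_suml.
  apply: eq_big => [[p q]|[p q] /setIdP[/setXP[Pp Qq] _]] /=.
    by rewrite 2!inE /= andbA.
  rewrite /h repr_mxM ?inE //= mulmxA row_sum_mul // -mulmxA mul_col_sum //.
  by rewrite scalemxAr.
move=> x /andP[Ax PQ'x].
have [/existsP[i /existsP[j /and3P[/eqP rij /eqP cij ij]]] | x_inj] :=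
  boolP [exists i, exists j, [&& cell_row i == cell_row j,
           cell_col (x i) == cell_col (x j) & i != j]].
  exact: young_sandwich_eq0 rij cij ij.
have [i j rij cij | p [q [Pp Qq def_x]]] := @fiber_stab_mulP x.
  apply/eqP; apply: contraR x_inj => ij.
  by apply/existsP; exists i; apply/existsP; exists j; rewrite rij cij !eqxx.
case/imsetP: PQ'x; exists (p, q) => //.
by apply/setIdP; split; [apply/setXP | rewrite /h -def_x].
Qed.

End YoungSymmetrizer.

(* A class sum commutes with the group algebra, so it acts on the whole Specht
   module by the scalar by which it acts on the generating symmetrizer. *)
Lemma sum_chi_class_sum (A : {set 'S_n}) (w : algC) :
    (forall y : 'S_n, A :^ y = A)%g ->
    (forall m (rG : mx_representation algC [set: 'S_n]%G m),
      row_sum rG *m (\sum_(x in A) rG x) *m col_sum rG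
        = w *: (row_sum rG *m col_sum rG)) ->
  \sum_(x in A) chi n lam x = w * char_degree n lam.
Proof.
move=> normA actA; rewrite /char_degree /chi cfRepr1.
rewrite (eq_bigr (fun x => \tr (specht_repr n lam x))) => [|x _]; last first.
  by rewrite cfunE in_setT.
(* It suffices that the class sum acts as the scalar matrix [w], whose trace is [w] times the
   degree. *)
rewrite -raddf_sum /= mulr_natr -mxtrace_scalar; congr (\tr _).
set aG := regular_repr algC [set: 'S_n]%G.
pose Z := \sum_(x in A) aG x.
have ZJ y : aG y *m Z = Z *m aG y.
  rewrite mulmx_sumr mulmx_suml (reindex_inj (conjg_inj y)) /=.
  apply: eq_big => [x|x _]; first by rewrite -{1}(normA y) memJ_conjg.
  by rewrite -!repr_mxM ?inE // -conjgC.
have def_e : young_symmetrizer n lam = gring_row (row_sum aG *m col_sum aG).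
  rewrite /row_sum mulmx_suml linear_sum; apply: eq_bigr => p _.
  rewrite mulmx_sumr linear_sum; apply: eq_bigr => q _.
  rewrite -scalemxAr -repr_mxM ?inE // linearZ /=; congr (_ *: _).
  by rewrite /gring_row rowK gring_indexK ?inE // mul1g.
have actZ : young_symmetrizer n lam *m Z = w *: young_symmetrizer n lam.
  (* Centrality puts [Z] between the row sum and the column sum, where [actA] applies. *)
  have ZC : Z *m col_sum aG = col_sum aG *m Z.
    rewrite mulmx_sumr [RHS]mulmx_suml; apply: eq_bigr => q _.
    by rewrite -scalemxAr -scalemxAl ZJ.
  by rewrite def_e -gring_row_mul -mulmxA -ZC mulmxA actA linearZ.
apply: val_submod_inj.
transitivity (val_submod 1%:M *m Z :
                'M_(\rank (cyclic_mx aG (young_symmetrizer n lam)), _)).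
  rewrite linear_sum /= mulmx_sumr; apply: eq_bigr => x _.
  by rewrite -[specht_repr n lam x]mul1mx val_submodJ ?inE.
rewrite -[w%:M]scalemx1 linearZ /=.
apply/row_matrixP => i; rewrite row_mul [RHS]linearZ /=.
(* Each basis vector of the module is the generator times some [B] in the group algebra, and [Z]
   commutes with [B]. *)
have /cyclic_mxP[B B_G ->] : (row i (val_submod 1%:M)
    <= cyclic_mx aG (young_symmetrizer n lam))%MS.
  exact: submx_trans (row_sub _ _) (val_submodP _).
have ZB : B *m Z = Z *m B.
  case/envelop_mxP: B_G => a ->; rewrite mulmx_suml mulmx_sumr.
  by apply: eq_bigr => y _; rewrite -scalemxAl -scalemxAr ZJ.
by rewrite -mulmxA ZB mulmxA actZ scalemxAl.
Qed.

(** * Colored permutations as row permutations *)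

Local Notation coloring := {dffun forall i : 'I_k, 'I_(conj_part lam i)}.
Local Notation P := (fiber_stab cell_row).

Lemma color_lt (c : coloring) (j : 'I_k) : (j < nth 0%N lam (c j))%N.
Proof. by rewrite -conj_partP. Qed.

(** A coloring selects one cell per column, the color being its row. *)
Definition color_cell (c : coloring) (j : 'I_k) : 'I_n := cell (color_lt c j).

Lemma color_cell_row c j : cell_row (color_cell c j) = c j.
Proof. exact: cell_rowK. Qed.

Lemma color_cell_col c j : ord_col (color_cell c j) = j.
Proof. by apply: val_inj; apply: cell_colK. Qed.

Lemma color_cell_inj c : injective (color_cell c).
Proof. exact: can_inj (color_cell_col c). Qed.

(** The indices that keep a colored permutation from being a derangement; the 0-based color 0 stands
    for 1. *)
Definition color_zeros (cs : coloring * 'S_k) : {set 'I_k} :=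
  [set j | (cs.2 j == j) && (cs.1 j == 0 :> nat)%N].

Definition color_cells (c : coloring) (B : {set 'I_k}) : {set 'I_n} :=
  [set color_cell c j | j in ~: B].

Definition color_shift (c : coloring) (s : 'S_k) (B : {set 'I_k}) (x : 'I_n) :=
  if x \in color_cells c B then color_cell c (s (ord_col x)) else x.

Definition color_move (c : coloring) (s : 'S_k) (B : {set 'I_k}) : 'S_n :=
  perm_of (color_shift c s B).

Lemma mem_color_cells c B j :
  (color_cell c j \in color_cells c B) = (j \notin B).
Proof. by rewrite mem_imset ?inE //; apply: color_cell_inj. Qed.

(** [s] fixes [B] pointwise, hence preserves its complement, so shifted cells never land on
    unshifted ones. *)
Lemma color_shift_inj c (s : 'S_k) (B : {set 'I_k}) :
  B \subset color_zeros (c, s) -> injective (color_shift c s B).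
Proof.
move=> sBZ; have sB j : s j \in B -> j \in B.
  move=> sBj; move/subsetP/(_ _ sBj): sBZ; rewrite inE /= => /andP[/eqP eq_s _].
  by rewrite -(perm_inj eq_s).
have moved x y : x \in color_cells c B -> y \notin color_cells c B ->
    color_cell c (s (ord_col x)) <> y.
  case/imsetP=> j B'j -> ; rewrite color_cell_col => S'y def_y.
  move: S'y; rewrite -def_y mem_color_cells negbK => /sB.
  by rewrite inE in B'j; apply/negP.
move=> x y; rewrite /color_shift; case: ifPn => [Sx | S'x]; case: ifPn => [Sy | S'y] //.
- case/imsetP: Sx Sy => j _ -> /imsetP[j' _ ->].
  by rewrite !color_cell_col => /color_cell_inj/perm_inj->.
- by move/(moved _ _ Sx S'y).
- by move/esym/(moved _ _ Sy S'x).
Qed.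

(** This covers [j] in [B] as well, where the cell stays put and [s j = j]. *)
Lemma color_moveE c (s : 'S_k) (B : {set 'I_k}) j :
    B \subset color_zeros (c, s) ->
  color_move c s B (color_cell c j) = color_cell c (s j).
Proof.
move=> sBZ; rewrite perm_ofE; last exact: color_shift_inj.
rewrite /color_shift mem_color_cells color_cell_col.
case: ifPn => // /negbNE/(subsetP sBZ).
by rewrite inE /= => /andP[/eqP-> _].
Qed.

Lemma color_move_out c (s : 'S_k) (B : {set 'I_k}) x :
    B \subset color_zeros (c, s) -> x \notin color_cells c B ->
  color_move c s B x = x.
Proof.
move=> sBZ S'x; rewrite perm_ofE; last exact: color_shift_inj.
by rewrite /color_shift (negbTE S'x).
Qed.

(** * The bijection from triples (c, sigma, B) to pairs (p, A) *)

Definition row_moves : {set 'S_n * {set 'I_n}} :=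
  [set pA : 'S_n * {set 'I_n} | (pA.1 \in P) && (perm_on pA.2 pA.1
                             && dinjectiveb cell_col [in pA.2])].

Definition color_moves : {set (coloring * 'S_k) * {set 'I_k}} :=
  [set csB : (coloring * 'S_k) * {set 'I_k} | (csB.1 \in colored_perms lam)
             && (csB.2 \subset color_zeros csB.1)].

Definition row_move (csB : (coloring * 'S_k) * {set 'I_k}) :
    'S_n * {set 'I_n} :=
  (color_move csB.1.1 csB.1.2 csB.2, color_cells csB.1.1 csB.2).

(** The columns met by [A] determine [B]. Colors are the rows of the cells of [A] off [B], and 0 on
    [B]; then [p] determines [s]. *)
Lemma row_move_inj : {in color_moves &, injective row_move}.
Proof.
move=> [[c s] B] [[c' s'] B'] /setIdP[_ /= sBZ] /setIdP[_ /= sBZ'].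
case=> eq_move eq_cells.
have col_cells d D : ord_col @: color_cells d D = ~: D.
  rewrite -imset_comp -[RHS]imset_id; apply: eq_imset => j.
  exact: color_cell_col.
have def_B : B' = B by apply: setC_inj; rewrite -(col_cells c') -eq_cells col_cells.
rewrite {B'}def_B in sBZ' eq_move eq_cells *.
have eq_cell j : color_cell c j = color_cell c' j.
  apply: cell_inj; last first.
    by rewrite [LHS]cell_colK [RHS]cell_colK.
  rewrite !color_cell_row; have [Bj | B'j] := boolP (j \in B).
    move/subsetP/(_ _ Bj): sBZ; move/subsetP/(_ _ Bj): sBZ'.
    by rewrite !inE /= => /andP[_ /eqP->] /andP[_ /eqP->].
  have: color_cell c j \in color_cells c' B by rewrite -eq_cells mem_color_cells.
  case/imsetP=> j' _ eq_jj'; have def_j := congr1 ord_col eq_jj'.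
  rewrite !color_cell_col in def_j.
  by rewrite -!color_cell_row eq_jj' -def_j.
have -> : c' = c.
  by apply/ffunP => j; apply: val_inj; rewrite /= -!color_cell_row eq_cell.
have -> // : s' = s.
apply/permP => j; apply: (@color_cell_inj c').
by rewrite -(color_moveE _ sBZ') -eq_move -!eq_cell color_moveE.
Qed.

Lemma row_move_mem csB : csB \in color_moves -> row_move csB \in row_moves.
Proof.
case: csB => [[c s] B] /setIdP[] /=; rewrite inE => /forallP/= cs sBZ.
apply/setIdP; split=> /=.
  apply/fiber_stabP => x.
  have [/imsetP[j _ ->] | S'x] := boolP (x \in color_cells c B).
    by rewrite color_moveE // !color_cell_row (eqP (cs j)).
  by rewrite color_move_out.
apply/andP; split.
  apply/subsetP => x; rewrite inE; apply: contraR => S'x.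
  by rewrite color_move_out.
apply/dinjectiveP => x y /imsetP[j _ ->] /imsetP[j' _ ->] eq_col.
rewrite -(color_cell_col c j) -(color_cell_col c j'); congr color_cell.
exact: val_inj.
Qed.

(** A column meeting [A] takes as color the row of its only cell in [A]. The other columns form [B]
    and take color 0. The permutation of columns follows [p] on the selected cells. *)
Lemma row_move_surj pA :
  pA \in row_moves -> exists2 csB, csB \in color_moves & pA = row_move csB.
Proof.
case: pA => p A /setIdP[/= /fiber_stabP Pp /andP[pA /dinjectiveP A_inj]].
have ex_cell (j : 'I_k) : exists u : 'I_(conj_part lam j), forall x,
    cell_col x = j -> if j \in ord_col @: A then (x \in A) = (cell_row x == u)
                      else u = 0%N :> nat.
  case: imsetP => [[x Ax ->] | _].
    exists (Ordinal (cell_row_conj x)) => y /= cy; apply/idP/eqP => [Ay | ry].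
      by rewrite (A_inj _ _ Ay Ax).
    by rewrite (cell_inj ry cy).
  have lt0 : (0 < conj_part lam j)%N by rewrite conj_partP nth0.
  by exists (Ordinal lt0).
have [c0 c0P] := fin_all_exists ex_cell.
pose c : coloring := finfun c0; pose B := ~: (ord_col @: A).
have cB j : j \in B -> c j = 0%N :> nat.
  rewrite inE => /negbTE B'j.
  by have := c0P j _ (cell_colK (color_lt c j)); rewrite B'j ffunE.
have cell_mem j : (color_cell c j \in A) = (j \notin B).
  have := c0P j _ (cell_colK (color_lt c j)); rewrite inE negbK -/(color_cell c j).
  case: ifPn => [_ -> | A'j _]; first by rewrite cell_rowK ffunE eqxx.
  apply: contraNF A'j => Ac; rewrite -[j](color_cell_col c).
  exact: imset_f.
have cellA x : x \in A -> color_cell c (ord_col x) = x.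
  move=> Ax; apply: A_inj => //; last exact: cell_colK.
  by rewrite [_ \in _]cell_mem inE negbK imset_f.
have pAE x : (p x \in A) = (x \in A) by rewrite (perm_closed _ pA).
pose f j := ord_col (p (color_cell c j)).
have fE j : color_cell c (f j) = p (color_cell c j).
  have [Bj | B'j] := boolP (j \in B); last first.
    by apply: cellA; rewrite pAE cell_mem.
  have pj : p (color_cell c j) = color_cell c j.
    by apply: out_perm pA _; rewrite cell_mem Bj.
  by rewrite /f pj color_cell_col.
have f_inj : injective f.
  move=> j j' eq_f; apply: (@color_cell_inj c); apply: (@perm_inj _ p).
  by rewrite -!fE eq_f.
have csB : ((c, perm f_inj), B) \in color_moves.
  rewrite !inE /=; apply/andP; split.
    apply/forallP => j; rewrite permE /=.
    by rewrite -(color_cell_row c j) -(color_cell_row c (f j)) fE Pp.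
  apply/subsetP => j Bj; rewrite inE /= permE cB // eqxx andbT.
  by apply/eqP/(@color_cell_inj c); rewrite fE (out_perm pA) // cell_mem Bj.
have sBZ : B \subset color_zeros (c, perm f_inj) by case/setIdP: csB.
have def_A : A = color_cells c B.
  apply/setP => x; apply/idP/imsetP => [Ax | [j B'j ->]].
    by exists (ord_col x); rewrite ?cellA // !inE negbK imset_f.
  by rewrite cell_mem; rewrite inE in B'j.
exists ((c, perm f_inj), B) => //; rewrite /row_move /= -def_A; congr pair.
apply/permP => x; have [Ax | A'x] := boolP (x \in A).
  by rewrite -(cellA x Ax) color_moveE // permE fE.
by rewrite color_move_out -?def_A // (out_perm pA).
Qed.

Lemma sum_row_moves :
  \sum_(p in P)
     \sum_(A : {set 'I_n} | perm_on A p && dinjectiveb cell_col [in A])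
       (-1) ^+ #|~: A|
  = (-1) ^+ (n - k)%N * (num_colored_derangements lam)%:R :> algC.
Proof.
have le_kn : (k <= n)%N.
  by rewrite /first_part; case: lam => //= a l; apply: leq_addr.
rewrite pair_big_dep /= (eq_bigl [in row_moves]) => [|pA]; last by rewrite [RHS]in_set.
have -> : row_moves = row_move @: color_moves.
  apply/setP => pA; apply/idP/imsetP => [/row_move_surj[csB] | [csB CB ->]].
    by exists csB.
  exact: row_move_mem.
rewrite big_imset /=; last exact: row_move_inj.
transitivity (\sum_(cs in colored_perms lam)
    \sum_(B : {set 'I_k} | B \subset color_zeros cs)
       (-1) ^+ (n - k)%N * (-1) ^+ #|B| : algC).
  rewrite pair_big_dep; apply: eq_big => [csB | [[c s] B] _]; first by rewrite inE.
  rewrite -exprD; congr (_ ^+ _).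
  (* [A] has [k - #|B|] cells, so its complement has [(n - k) + #|B|]. *)
  have def_n := cardsC (color_cells c B); rewrite card_ord in def_n.
  have def_k := cardsC B; rewrite card_ord in def_k.
  have card_cells : #|color_cells c B| = #|~: B|.
    by apply: card_imset; apply: color_cell_inj.
  apply/eqP; rewrite -(eqn_add2l #|color_cells c B|) def_n card_cells.
  by rewrite addnC -addnA def_k subnK.
(* The alternating sum over [B] keeps the colored permutations with empty [color_zeros], that is,
   the derangements. *)
under eq_bigr do rewrite -mulr_sumr sum_subset_sign.
rewrite -mulr_sumr -natr_sum -big_mkcondr sum1_card; congr (_ * _%:R).
apply: eq_card => cs; rewrite !inE; congr (_ && _); first by rewrite inE.
apply/eqP/forallP => [Z0 j | cs_der].
  apply/implyP => sj; apply/negP => cj.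
  by move/setP/(_ j): Z0; rewrite !inE sj cj.
apply/setP => j; rewrite !inE; apply/andP => -[sj cj].
by move: (cs_der j); rewrite sj cj.
Qed.

End Cells.

Theorem corollary17 (n : nat) (lam : seq nat) (n_gt0 : (0 < n)%N)
    (lam_part : is_partition_of n lam) :
  derangement_char_sum n lam =
    (-1) ^+ (sumn lam - first_part lam)%N * char_degree n lam
      * (num_colored_derangements lam)%:R.
Proof.
case/and3P: lam_part => lam_sorted _ /eqP def_n.
(* The coefficient of the degree is turned back into the signed sum over pairs [p], [q], the scalar
   by which the sum of derangements acts. *)
subst n; rewrite mulrAC -(sum_row_moves lam_sorted).
rewrite -(sum_sign_fixed_point_free (@cell_inj lam)).
apply: sum_chi_class_sum => [y | m rG].
  apply/setP => x; rewrite mem_conjg !inE; apply/forallP/forallP => fx i.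
    by have := fx (y^-1 i)%g; rewrite permJ (inj_eq perm_inj).
  by rewrite -[i](permK y) permJ (inj_eq perm_inj).
rewrite young_sandwich_sum; congr (_ *: _).
by apply: eq_bigr => p _; apply: eq_bigl => q; congr (_ && _); rewrite inE.
Qed.
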